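(* Let $K$ be a field and let $f = x^{C}(x^{A}-\rho x^{B}) \in K[x_1,\dots,x_n]$ be any binomial, with $\rho\in K^\times$ and $A,B,C\in\mathbb{Z}_{\ge0}^n$ such that $A_iB_i=0$ for all $i\in\{1,\dots,n\}$. Then the local monomialization process for $f$ obtained by choosing the centers according to the following rule terminates (for arbitrary admissible choices of centers). In a chart with data $(A,B,C)$ satisfying condition (N) of the context and with set $E\subseteq\{1,\dots,n\}$ of exceptional indices, put $\alpha:=\max_i A_i$ and $\beta:=\max_i B_i$: (a) if there exist $j_1,j_2$ with $A_{j_1}=\alpha$, $B_{j_2}=\beta$ and $\{j_1,j_2\}\cap E\neq\varnothing$ (equivalently, $V(x_{j_1},x_{j_2})$ is contained in the exceptional locus), choose such $j_1,j_2$ and take the center $V(x_{j_1},x_{j_2})$; (b) otherwise take the center $D_I=V(x_i\mid i\in I)$, where $I$ is chosen as follows: (i) if $\min\{\alpha,\beta\}\ge 2$ or $\min\{|A|,|B|\}=1$, then $I=\{j_1,j_2\}$ with $A_{j_1}=\alpha$ and $B_{j_2}=\beta$; (ii) if $\alpha=1$, $\beta\ge2$ and $\min\{|A|,|B|\}\ge2$, then $I=\{j_1,j_2,j_3\}$ with $j_1,j_2,j_3$ pairwise distinct, $A_{j_1}=A_{j_2}=1$ and $B_{j_3}=\beta$; (iii) if $\alpha\ge2$, $\beta=1$ and $\min\{|A|,|B|\}\ge2$, then $I=\{j_1,j_2,j_3\}$ with $j_1,j_2,j_3$ pairwise distinct, $A_{j_1}=\alpha$ and $B_{j_2}=B_{j_3}=1$;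 (iv) if $\alpha=\beta=1$ and $\min\{|A|,|B|\}\ge2$, then $I=\{j_1,j_2,j_3,j_4\}$ with $j_1,j_2,j_3,j_4$ pairwise distinct and $A_{j_1}=A_{j_2}=B_{j_3}=B_{j_4}=1$.
   Context: Notation: for $A=(A_1,\dots,A_n)\in\mathbb{Z}_{\ge0}^n$, $x^A := x_1^{A_1}\cdots x_n^{A_n}$ and $|A| := \sum_{i=1}^n A_i$. Conditions: for $f = x^C(x^A - \rho x^B)$ with $A_iB_i=0$ for all $i$, condition (M) is: either $\min\{|A|,|B|\} = 0$, or there is an index $i$ with $C_i = 0$ such that ($|A| = 1$ and $A_i = 1$) or ($|B|=1$ and $B_i=1$). Condition (N) is the negation of (M): either $\min\{|A|,|B|\}\ge 2$, or $\min\{|A|,|B|\} = 1$ and $C_i \ne 0$ for every $i$ such that ($|A|=1$ and $A_i=1$) or ($|B|=1$ and $B_i = 1$). (If (M) holds, then $f$ is locally a monomial, i.e. at every point it is a monomial times a unit in a suitable regular system of parameters.) Blowup charts: for $I\subseteq\{1,\dots,n\}$ the blowup of $\mathbb{A}^n_K$ in $V(x_i\mid i\in I)$ is covered by charts $D_+(X_j)\cong \mathbb{A}^n_K$, $j\in I$, on which it is given by $x_k\mapsto x_j'x_k'$ for $k\in I\setminus\{j\}$ and $x_k\mapsto x_k'$ for $k=j$ or $k\notin I$. The total transform of $f$ in the chart is its image in $K[x']$, written as $x'^{C'}(x'^{A'}-\rho x'^{B'})$ with $A'_iB'_i=0$ for all $i$. On exponents, with $\delta := \min\{\sum_{k\in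 I}A_k,\sum_{k\in I}B_k\}$, one has $A'_j = \sum_{k\in I}A_k - \delta$, $B'_j=\sum_{k\in I}B_k-\delta$, $C'_j = \sum_{k\in I}C_k+\delta$, and all other entries of $A,B,C$ are unchanged. Exceptional indices: each chart carries a set $E\subseteq\{1,\dots,n\}$ of indices $i$ for which $\mathrm{div}(x_i)$ is an exceptional divisor of the preceding blowups. Initially $E=\varnothing$; passing to the chart $D_+(X_j)$ of a blowup replaces $E$ by $E\cup\{j\}$. The exceptional locus in the chart is $\mathrm{div}(\prod_{i\in E}x_i)$. Local monomialization process: start with the chart $\mathbb{A}^n_K$ and $f$. If the data $(A,B,C)$ of a chart satisfies (M), the chart is final. Otherwise choose a center $D_I$ by the given rule applied to that chart's data (independently of the other charts), blow up, and continue in each chart $D_+(X_j)$, $j\in I$, with the total transform $x'^{C'}(x'^{A'}-\rho x'^{B'})$. The process terminates if the resulting tree of charts is finite (so that all its leaves satisfy (M)), whatever choices of centers are made. *)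

(* Defs.v *)
From HB Require Import structures.
From mathcomp Require Import all_boot all_order all_algebra.
From mathcomp.multinomials Require Export mpoly.

Set Implicit Arguments.
Unset Strict Implicit.
Unset Printing Implicit Defensive.

Import GRing.Theory.
Local Open Scope ring_scope.

Definition binomial_poly (K : fieldType) (n : nat) (rho : K)
    (A B C : 'X_{1..n}) : {mpoly K[n]} :=
  'X_[C] * ('X_[A] - rho *: 'X_[B]).

(** A chart of the process: an affine space with coordinates [x_0 .. x_(n-1)],
    the total transform of [f] in it, the exponent data [(A, B, C)] of this
    total transform, and the set of exceptional indices. That the exponents
    are those of the polynomial is [chart_data] below, which holds at the
    initial chart and is preserved by blowups ([blowup_chart_data]). *)
Record chart (K : fieldType) (n : nat) := Chart {
  ctransf : {mpoly K[n]};
  expA : 'X_{1..n};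
  expB : 'X_{1..n};
  expC : 'X_{1..n};
  exc : {set 'I_n}
}.

Definition initial_chart (K : fieldType) (n : nat) (rho : K)
    (A B C : 'X_{1..n}) : chart K n :=
  Chart (binomial_poly rho A B C) A B C set0.

Definition chart_data (K : fieldType) (n : nat) (rho : K) (c : chart K n) : Prop :=
  ctransf c = binomial_poly rho (expA c) (expB c) (expC c)
  /\ forall i, (expA c i * expB c i = 0)%N.

(** The map [K[x] -> K[x']] of the chart [D_+(X_j)] of the blowup in
    [V(x_i | i \in I)]. *)
Definition total_transform (K : fieldType) (n : nat) (I : {set 'I_n}) (j : 'I_n)
    (p : {mpoly K[n]}) : {mpoly K[n]} :=
  p \mPo [tuple (if (k \in I) && (k != j) then 'X_j * 'X_k else 'X_k) | k < n].

Definition set_exp (n : nat) (m : 'X_{1..n}) (j : 'I_n) (v : nat) : 'X_{1..n} :=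
  [multinom (if i == j then v else m i) | i < n].

(** The chart [D_+(X_j)], meaningful for [j \in I]. *)
Definition blowup_chart (K : fieldType) (n : nat) (I : {set 'I_n}) (j : 'I_n)
    (c : chart K n) : chart K n :=
  let: a := (\sum_(k in I) expA c k)%N in
  let: b := (\sum_(k in I) expB c k)%N in
  let: delta := minn a b in
  Chart (total_transform I j (ctransf c))
        (set_exp (expA c) j (a - delta)%N)
        (set_exp (expB c) j (b - delta)%N)
        (set_exp (expC c) j (\sum_(k in I) expC c k + delta)%N)
        (j |: exc c).

Definition condM (K : fieldType) (n : nat) (c : chart K n) : bool :=
  let: A := expA c in let: B := expB c in let: C := expC c in
  (minn (mdeg A) (mdeg B) == 0)%N ||
  [exists i, (C i == 0)%N &&
     ((mdeg A == 1) && (A i == 1) || (mdeg B == 1) && (B i == 1))%N].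

Definition condN (K : fieldType) (n : nat) (c : chart K n) : bool := ~~ condM c.

Lemma condNE (K : fieldType) (n : nat) (c : chart K n) :
  condN c =
  (2 <= minn (mdeg (expA c)) (mdeg (expB c)))%N ||
  (minn (mdeg (expA c)) (mdeg (expB c)) == 1)%N &&
  [forall i, ((mdeg (expA c) == 1) && (expA c i == 1) ||
              (mdeg (expB c) == 1) && (expB c i == 1))%N ==> (expC c i != 0)%N].
Proof.
rewrite /condN /condM negb_or negb_exists.
set P := [forall _, _]; set Q := [forall _, _].
have -> : P = Q.
  by apply: eq_forallb => i; rewrite implybE negb_and orbC.
case E: (minn _ _) => [|[|m]] //=.
apply/forallP => i; apply/implyP.
by case/orP => /andP[/eqP h _]; move: E; rewrite h /minn; case: ifP => // h1 E;
  move: h1; rewrite E.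
Qed.

Definition max_exp (n : nat) (m : 'X_{1..n}) : nat := (\max_(i < n) m i)%N.

Definition max_pair (K : fieldType) (n : nat) (c : chart K n) (j1 j2 : 'I_n) : bool :=
  (expA c j1 == max_exp (expA c)) && (expB c j2 == max_exp (expB c)).

Definition case_a (K : fieldType) (n : nat) (c : chart K n) (j1 j2 : 'I_n) : bool :=
  max_pair c j1 j2 && ([set j1; j2] :&: exc c != set0).

Inductive center_b (K : fieldType) (n : nat) (c : chart K n) : {set 'I_n} -> Prop :=
| Center_b_i j1 j2 of
    (2 <= minn (max_exp (expA c)) (max_exp (expB c)))%N
      || (minn (mdeg (expA c)) (mdeg (expB c)) == 1)%N &
    max_pair c j1 j2 :
    center_b c [set j1; j2]
| Center_b_ii j1 j2 j3 of
    max_exp (expA c) = 1%N & (2 <= max_exp (expB c))%N &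
    (2 <= minn (mdeg (expA c)) (mdeg (expB c)))%N &
    uniq [:: j1; j2; j3] &
    expA c j1 = 1%N & expA c j2 = 1%N & expB c j3 = max_exp (expB c) :
    center_b c [set j1; j2; j3]
| Center_b_iii j1 j2 j3 of
    (2 <= max_exp (expA c))%N & max_exp (expB c) = 1%N &
    (2 <= minn (mdeg (expA c)) (mdeg (expB c)))%N &
    uniq [:: j1; j2; j3] &
    expA c j1 = max_exp (expA c) & expB c j2 = 1%N & expB c j3 = 1%N :
    center_b c [set j1; j2; j3]
| Center_b_iv j1 j2 j3 j4 of
    max_exp (expA c) = 1%N & max_exp (expB c) = 1%N &
    (2 <= minn (mdeg (expA c)) (mdeg (expB c)))%N &
    uniq [:: j1; j2; j3; j4] &
    expA c j1 = 1%N & expA c j2 = 1%N & expB c j3 = 1%N & expB c j4 = 1%N :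
    center_b c [set j1; j2; j3; j4].

(** [admissible_center c I]: the rule allows the center [V(x_i | i \in I)] in
    a chart [c] satisfying [condN]. *)
Inductive admissible_center (K : fieldType) (n : nat) (c : chart K n) :
    {set 'I_n} -> Prop :=
| Center_a j1 j2 of case_a c j1 j2 : admissible_center c [set j1; j2]
| Center_b I of (forall j1 j2, ~~ case_a c j1 j2) & center_b c I :
    admissible_center c I.

(** Charts that occur in the process for some choices of centers. *)
Inductive reachable (K : fieldType) (n : nat) (c0 : chart K n) : chart K n -> Prop :=
| Reach_root : reachable c0 c0
| Reach_blowup c I j of reachable c0 c & condN c & admissible_center c I & j \in I :
    reachable c0 (blowup_chart I j c).

(** The tree of charts for given choices of centers. A node is addressed by the
    sequence of the indices [j] of the charts [D_+(X_j)] leading to it from the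
    root, and [choice p] is the center chosen at address [p], so that the
    centers in different charts are chosen independently, even if the data of
    these charts coincide. *)
Inductive process_tree (K : fieldType) (n : nat) (c0 : chart K n)
    (choice : seq 'I_n -> {set 'I_n}) : seq 'I_n -> chart K n -> Prop :=
| Tree_root : process_tree c0 choice [::] c0
| Tree_child p c j of process_tree c0 choice p c & condN c & j \in choice p :
    process_tree c0 choice (rcons p j) (blowup_chart (choice p) j c).

Definition admissible_choice (K : fieldType) (n : nat) (c0 : chart K n)
    (choice : seq 'I_n -> {set 'I_n}) : Prop :=
  forall p c, process_tree c0 choice p c -> condN c ->
  admissible_center c (choice p).

Definition finite_tree (K : fieldType) (n : nat) (c0 : chart K n)
    (choice : seq 'I_n -> {set 'I_n}) : Prop :=
  exists s : seq (seq 'I_n), forall p c, process_tree c0 choice p c -> p \in s.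

Definition leaf (K : fieldType) (n : nat) (c0 : chart K n)
    (choice : seq 'I_n -> {set 'I_n}) (p : seq 'I_n) (c : chart K n) : Prop :=
  process_tree c0 choice p c /\
  forall j c', ~ process_tree c0 choice (rcons p j) c'.

(** The first condition says that the process never gets stuck: without it the
    second one could hold for want of admissible choices. *)
Definition process_terminates (K : fieldType) (n : nat) (c0 : chart K n) : Prop :=
  (forall c, reachable c0 c -> condN c -> exists I, admissible_center c I) /\
  (forall choice, admissible_choice c0 choice ->
     finite_tree c0 choice /\ forall p c, leaf c0 choice p c -> condM c).

Lemma total_transformX (K : fieldType) (n : nat) (I : {set 'I_n}) (j : 'I_n)
    (m : 'X_{1..n}) : j \in I ->
  total_transform I j 'X_[m] =
  'X_[set_exp m j (\sum_(k in I) m k)%N] :> {mpoly K[n]}.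
Proof.
move=> jI; rewrite /total_transform comp_mpolyX.
pose e (k : 'I_n) : 'X_{1..n} :=
  (if (k \in I) && (k != j) then U_(j) + U_(k) else U_(k))%MM.
rewrite (eq_bigr (fun k => 'X_[(e k *+ m k)%MM])); last first.
  by move=> k _; rewrite tnth_mktuple /e -mpolyXn; case: ifP; rewrite ?mpolyXD.
rewrite mprodXE; congr 'X_[_]; apply/mnmP => i; rewrite mnm_sumE mnmE.
case: eqP => [->|/eqP ij].
  rewrite [RHS]big_mkcond; apply: eq_bigr => k _; rewrite mulmnE /e.
  case: (eqVneq k j) => [->|kj] /=; first by rewrite andbF jI mnm1E eqxx mul1n.
  rewrite andbT; case: ifP => kI; rewrite ?mnmDE !mnm1E ?eqxx (negPf kj) //.
  by rewrite addn0 mul1n.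
rewrite (bigD1 i) //= big1 => [|k ki]; rewrite mulmnE /e.
  by case: ifP => _; rewrite ?mnmDE !mnm1E eqxx 1?eq_sym ?(negPf ij) ?addn0 ?mul1n // eq_sym (negPf ij) add0n mul1n.
by case: ifP => _; rewrite ?mnmDE !mnm1E (negPf ki) // eq_sym (negPf ij).
Qed.

Lemma initial_chart_data (K : fieldType) (n : nat) (rho : K) (A B C : 'X_{1..n}) :
  (forall i, (A i * B i = 0)%N) -> chart_data rho (initial_chart rho A B C).
Proof. by []. Qed.

Lemma blowup_chart_data (K : fieldType) (n : nat) (rho : K) (c : chart K n)
    (I : {set 'I_n}) (j : 'I_n) : j \in I ->
  chart_data rho c -> chart_data rho (blowup_chart I j c).
Proof.
move=> jI [fE dAB]; split=> [|i] /=; last first.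
  rewrite !mnmE; case: eqP => // _; case: leqP => _; rewrite subnn ?muln0 //.
have ttM p q : @total_transform K n I j (p * q) =
    total_transform I j p * total_transform I j q by exact: rmorphM.
have ttB p q : @total_transform K n I j (p - q) =
    total_transform I j p - total_transform I j q by exact: comp_mpolyB.
have ttZ a p : @total_transform K n I j (a *: p) =
    a *: total_transform I j p by exact: comp_mpolyZ.
rewrite fE /binomial_poly ttM ttB ttZ !total_transformX //.
set a := (\sum_(k in I) expA c k)%N; set b := (\sum_(k in I) expB c k)%N.
set s := (\sum_(k in I) expC c k)%N; set d := minn a b.
rewrite !mulrBr -!scalerAr -!mpolyXD; congr (_ - _ *: _).
  congr 'X_[_]; apply/mnmP => i; rewrite !mnmDE !mnmE; case: eqP => // _.
  by rewrite -addnA subnKC // geq_minl.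
congr 'X_[_]; apply/mnmP => i; rewrite !mnmDE !mnmE; case: eqP => // _.
by rewrite -addnA subnKC // geq_minr.
Qed.

(* Main.v *)
(** Every rule (a), (i)-(iv) selects [I] so that in each chart [D_+(X_j)],
    [j \in I], both new exponents at [j] are smaller than the maxima [alpha] of
    [A] and [beta] of [B], while [A_j = alpha] or [B_j = beta] before the blowup.
    Hence neither maximum grows, and the pair ([alpha + beta], number of indices
    attaining [alpha] in [A] or [beta] in [B]) decreases lexicographically. This
    bounds the depth of the tree of charts. *)
Require Import Defs.
From mathcomp Require Import all_boot all_order all_algebra zify.
From mathcomp.multinomials Require Import mpoly.

Set Implicit Arguments.
Unset Strict Implicit.
Unset Printing Implicit Defensive.

Import GRing.Theory.
Local Open Scope ring_scope.

(** * Maximal exponents and their multiplicities *)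

Section MaxExp.
Local Open Scope nat_scope.
Variable n : nat.
Implicit Types m : 'X_{1..n}.

Lemma leq_max_exp m i : m i <= max_exp m.
Proof. exact: leq_bigmax. Qed.

Lemma max_exp_gt0 m : (0 < max_exp m) = (0 < mdeg m).
Proof.
apply/idP/idP; rewrite !lt0n; apply: contraNneq => m0.
  have -> : m = 0%MM by apply/eqP; rewrite -mdeg_eq0 m0.
  by rewrite -leqn0; apply/bigmax_leqP => i _; rewrite mnm0E.
by rewrite mdegE big1 // => i _; apply/eqP; rewrite -leqn0 -m0 leq_max_exp.
Qed.

Lemma max_exp_attained m : 0 < mdeg m -> exists i, m i = max_exp m.
Proof.
(* For [n = 0] the maximum is the default 0 of an empty [\max], attained nowhere; positive degree
   excludes this. *)
move=> m_gt0; suff n_gt0 : 0 < #|'I_n|.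
  by have [i max_i] := eq_bigmax (fun i => m i) n_gt0; exists i; rewrite -max_i.
rewrite card_ord lt0n; apply: contraTneq m_gt0 => n0.
by rewrite mdegE big1 // => i; have := ltn_ord i; rewrite [X in _ < X]n0.
Qed.

(** Supplies the pairs of indices with exponent 1 demanded by rules (ii)-(iv). *)
Lemma two_max_indices m : max_exp m = 1 -> 2 <= mdeg m ->
  exists i j, [/\ i != j, m i = 1 & m j = 1].
Proof.
move=> max1 m_ge2; have [i mi] := max_exp_attained (ltnW m_ge2).
have [j /andP[ji mj]|no_j] := pickP (fun j => (j != i) && (m j != 0)).
  exists i, j; split; [by rewrite eq_sym | by rewrite mi|].
  by apply/eqP; rewrite eqn_leq lt0n mj -max1 leq_max_exp.
move: m_ge2; rewrite mdegE (bigD1 i) //= mi max1 big1 // => j ji.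
by have := no_j j; rewrite ji => /negbFE/eqP.
Qed.

(** Nat encoding of the lexicographic pair (maximum, its multiplicity). *)
Definition level m := max_exp m * n.+1 + #|[set i | m i == max_exp m]|.

Lemma max_exp_set_exp m j v :
  v <= max_exp m -> max_exp (set_exp m j v) <= max_exp m.
Proof.
by move=> v_le; apply/bigmax_leqP => i _; rewrite mnmE;
  case: eqP => // _; apply: leq_max_exp.
Qed.

(** If the maximum survives, [j] no longer attains it and no index newly does; otherwise the maximum
    itself drops. *)
Lemma level_set_exp m j v : v < max_exp m ->
  level (set_exp m j v) + (m j == max_exp m) <= level m.
Proof.
move=> v_lt; rewrite /level; have := max_exp_set_exp j (ltnW v_lt).
rewrite leq_eqVlt => /predU1P[->|max_lt].
  rewrite -addnA leq_add2l [leqRHS](cardsD1 j) inE addnC leq_add2l.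
  apply/subset_leq_card/subsetP => i; rewrite !inE mnmE.
  by case: (i =P j) => // _ /eqP v_max; rewrite v_max ltnn in v_lt.
(* A drop of the maximum frees at least [n.+1], while the new multiplicity is at most [n]. *)
have := max_card (mem [set i | set_exp m j v i == max_exp (set_exp m j v)]).
rewrite card_ord; set k := #|_|; case: (m j =P _) => [mj|_] k_le; last first.
  have := leq_mul max_lt (leqnn n.+1); lia.
have : 0 < #|[set i | m i == max_exp m]|.
  by apply/card_gt0P; exists j; rewrite inE mj.
have := leq_mul max_lt (leqnn n.+1); lia.
Qed.

End MaxExp.

Lemma sum_set_seq (T : finType) (F : T -> nat) (I : {set T}) (s : seq T) :
  I =i s -> uniq s -> (\sum_(k in I) F k = \sum_(k <- s) F k)%N.
Proof. by move=> inI s_uniq; rewrite (eq_bigl _ _ inI) -big_uniq. Qed.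

(** * Existence of admissible centers *)

Section Process.
Variables (K : fieldType) (n : nat) (rho : K).
Implicit Types (c : chart K n) (I : {set 'I_n}) (j : 'I_n).
Local Open Scope nat_scope.

(** A plain sum suffices, since a blowup raises neither summand and lowers at least one. *)
Definition chart_level c := level (expA c) + level (expB c).

Lemma condN_max_exp_gt0 c : condN c ->
  0 < max_exp (expA c) /\ 0 < max_exp (expB c).
Proof. by rewrite condNE !max_exp_gt0 => /orP[|/andP[+ _]]; lia. Qed.

Lemma expB_eq0 c j : chart_data rho c -> 0 < expA c j -> expB c j = 0.
Proof. by case=> _ /(_ j); case: (expA c j) => // k; lia. Qed.

Lemma expA_eq0 c j : chart_data rho c -> 0 < expB c j -> expA c j = 0.
Proof. by case=> _ /(_ j); case: (expB c j) => // k; lia. Qed.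

Lemma exists_admissible_center c :
  chart_data rho c -> condN c -> exists I, admissible_center c I.
Proof.
move=> data N; have [a_gt0 b_gt0] := condN_max_exp_gt0 N.
have [j1 A_j1] : exists j, expA c j = max_exp (expA c).
  by apply: max_exp_attained; rewrite -max_exp_gt0.
have [j2 B_j2] : exists j, expB c j = max_exp (expB c).
  by apply: max_exp_attained; rewrite -max_exp_gt0.
have [/existsP[k1 /existsP[k2 case_ak]]|not_a] :=
    boolP [exists k1, [exists k2, case_a c k1 k2]].
  by exists [set k1; k2]; apply: Center_a.
suff [I cI] : exists I, center_b c I.
  exists I; apply: Center_b => // k1 k2; apply: contra not_a => case_ak.
  by apply/existsP; exists k1; apply/existsP; exists k2.
(* Disjointness of the supports of [A] and [B] yields the distinctness required in (ii)-(iv). *)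
have neqAB i k : expA c i > 0 -> expB c k > 0 -> i != k.
  move=> Ai Bk; apply: contraTneq Bk => <-.
  by rewrite expB_eq0.
have [case_i|] := boolP ((2 <= minn (max_exp (expA c)) (max_exp (expB c)))
      || (minn (mdeg (expA c)) (mdeg (expB c)) == 1)).
  by exists [set j1; j2]; apply: Center_b_i => //; rewrite /max_pair A_j1 B_j2 !eqxx.
rewrite negb_or => /andP[max_le1 deg_neq1].
have deg_ge2 : 2 <= minn (mdeg (expA c)) (mdeg (expB c)).
  by move: a_gt0 b_gt0; rewrite !max_exp_gt0; lia.
have [A_ge2 B_ge2] : 2 <= mdeg (expA c) /\ 2 <= mdeg (expB c) by lia.
have [a1|a_neq1] := eqVneq (max_exp (expA c)) 1;
  have [b1|b_neq1] := eqVneq (max_exp (expB c)) 1.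
- have [i1 [i2 [i12 Ai1 Ai2]]] := two_max_indices a1 A_ge2.
  have [k1 [k2 [k12 Bk1 Bk2]]] := two_max_indices b1 B_ge2.
  exists [set i1; i2; k1; k2]; apply: Center_b_iv => //.
  by rewrite /= !inE !negb_or i12 k12 !neqAB ?Ai1 ?Ai2 ?Bk1 ?Bk2.
- have [i1 [i2 [i12 Ai1 Ai2]]] := two_max_indices a1 A_ge2.
  exists [set i1; i2; j2]; apply: Center_b_ii => //; first lia.
  by rewrite /= !inE !negb_or i12 !neqAB ?Ai1 ?Ai2 ?B_j2.
- have [k1 [k2 [k12 Bk1 Bk2]]] := two_max_indices b1 B_ge2.
  exists [set j1; k1; k2]; apply: Center_b_iii => //; first lia.
  by rewrite /= !inE !negb_or k12 !neqAB ?A_j1 ?Bk1 ?Bk2.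
(* Both maxima would be at least 2, contrary to [max_le1]. *)
- lia.
Qed.

Lemma admissible_center_neq0 c I : admissible_center c I -> exists j, j \in I.
Proof.
by case=> [j1 j2 _|{}I _ [] j1 *]; exists j1; rewrite !inE eqxx.
Qed.

(** * Effect of a blowup on the maxima *)

(** The differences are the new exponents at the chart index, the same for every chart of the
    blowup. *)
Definition lowering_center c I :=
  let a := \sum_(k in I) expA c k in
  let b := \sum_(k in I) expB c k in
  [/\ a - minn a b < max_exp (expA c), b - minn a b < max_exp (expB c)
    & forall j, j \in I ->
        (expA c j == max_exp (expA c)) || (expB c j == max_exp (expB c))].

(** Serves (a) and (i): the sums over the center are the two maxima, both positive, so subtracting
    their minimum lowers each. *)
Lemma max_pair_lowering c j1 j2 : chart_data rho c -> condN c ->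
  max_pair c j1 j2 -> lowering_center c [set j1; j2].
Proof.
move=> data N /andP[/eqP A1 /eqP B2].
have [a_gt0 b_gt0] := condN_max_exp_gt0 N.
have B1 : expB c j1 = 0 by apply: expB_eq0; rewrite ?A1.
have A2 : expA c j2 = 0 by apply: expA_eq0; rewrite ?B2.
have j12 : j1 != j2 by apply: contraTneq b_gt0 => j12; rewrite -B2 -j12 B1.
rewrite /lowering_center !big_setU1 ?inE //= !big_set1 A1 A2 B1 B2.
by split=> [||j]; [lia..|rewrite !inE => /orP[]/eqP->; rewrite ?A1 ?B2 eqxx ?orbT].
Qed.

Lemma admissible_lowering c I : chart_data rho c -> condN c ->
  admissible_center c I -> lowering_center c I.
Proof.
move=> data N [j1 j2 /andP[maxj _]|{}I _ cI]; first exact: max_pair_lowering.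
case: cI => [j1 j2 _ maxj|j1 j2 j3 a1 b2 _ u A1 A2 B3
  |j1 j2 j3 a2 b1 _ u A1 B2 B3|j1 j2 j3 j4 a1 b1 _ u A1 A2 B3 B4].
- exact: max_pair_lowering.
- have [B1 B2] : expB c j1 = 0 /\ expB c j2 = 0.
    by split; apply: expB_eq0; rewrite ?A1 ?A2.
  have A3 : expA c j3 = 0 by apply: expA_eq0; rewrite ?B3 //; lia.
  have inI : [set j1; j2; j3] =i [:: j1; j2; j3].
    by move=> j; rewrite !inE orbA.
  rewrite /lowering_center !(sum_set_seq _ inI u) !big_cons !big_nil.
  (* The sums are 2 and [beta >= 2], so the new exponents are 0 and [beta - 2]; (iii) is
     symmetric. *)
  rewrite A1 A2 A3 B1 B2 B3 a1; split=> [||j]; [lia..|].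
  by rewrite inI !inE => /or3P[]/eqP->; rewrite ?A1 ?A2 ?B3 eqxx ?orbT.
- have [A2 A3] : expA c j2 = 0 /\ expA c j3 = 0.
    by split; apply: expA_eq0; rewrite ?B2 ?B3.
  have B1 : expB c j1 = 0 by apply: expB_eq0; rewrite ?A1 //; lia.
  have inI : [set j1; j2; j3] =i [:: j1; j2; j3].
    by move=> j; rewrite !inE orbA.
  rewrite /lowering_center !(sum_set_seq _ inI u) !big_cons !big_nil.
  rewrite A1 A2 A3 B1 B2 B3 b1; split=> [||j]; [lia..|].
  by rewrite inI !inE => /or3P[]/eqP->; rewrite ?A1 ?B2 ?B3 eqxx ?orbT.
- have [B1 B2] : expB c j1 = 0 /\ expB c j2 = 0.
    by split; apply: expB_eq0; rewrite ?A1 ?A2.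
  have [A3 A4] : expA c j3 = 0 /\ expA c j4 = 0.
    by split; apply: expA_eq0; rewrite ?B3 ?B4.
  have inI : [set j1; j2; j3; j4] =i [:: j1; j2; j3; j4].
    by move=> j; rewrite !inE !orbA.
  rewrite /lowering_center !(sum_set_seq _ inI u) !big_cons !big_nil.
  (* Both sums are 2, so both new exponents vanish. *)
  rewrite A1 A2 A3 A4 B1 B2 B3 B4 a1 b1; split=> [||j]; [lia..|].
  by rewrite inI !inE => /or4P[]/eqP->; rewrite ?A1 ?A2 ?B3 ?B4 eqxx ?orbT.
Qed.

Lemma chart_level_blowup c I j : chart_data rho c -> condN c ->
  admissible_center c I -> j \in I ->
  chart_level (blowup_chart I j c) < chart_level c.
Proof.
move=> data N cI jI.
have [a_lt b_lt /(_ _ jI) maxj] := admissible_lowering data N cI.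
have := level_set_exp j a_lt; have := level_set_exp j b_lt.
by rewrite /chart_level /=; case/orP: maxj => ->; lia.
Qed.

(** * Finiteness of the tree *)

Variables (c0 : chart K n) (data0 : chart_data rho c0).

Lemma reachable_chart_data c : reachable c0 c -> chart_data rho c.
Proof. by elim=> // {}c I j _ data _ _ jI; apply: blowup_chart_data. Qed.

(** Each step down lengthens the address by one and costs at least one unit of level. *)
Lemma tree_depth_level choice p c : admissible_choice c0 choice ->
  process_tree c0 choice p c ->
  chart_data rho c /\ size p + chart_level c <= chart_level c0.
Proof.
move=> adm; elim=> [|{}p {}c j tree [data level_le] N jp]; first by [].
split; first exact: blowup_chart_data.
have := chart_level_blowup data N (adm _ _ tree N) jp.
by rewrite size_rcons; lia.
Qed.

Lemma process_terminates_of_data : process_terminates c0.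
Proof.
split=> [c /reachable_chart_data data N|choice adm].
  exact: exists_admissible_center.
split=> [|p c [tree no_child]].
  (* All words over ['I_n] of length at most the initial level: a finite list containing every
     address. *)
  exists [seq val b | b <- enum {: (chart_level c0).-bseq 'I_n}] => p c tree.
  have [_ level_le] := tree_depth_level adm tree.
  have size_p : size p <= chart_level c0 by lia.
  by apply/mapP; exists (Bseq size_p); rewrite ?mem_enum.
(* A leaf violating (M) would have a nonempty center, hence a child. *)
apply: contraT => N; have [j jp] := admissible_center_neq0 (adm _ _ tree N).
by have := no_child j _ (Tree_child tree N jp).
Qed.

End Process.

Theorem corollary6p2 (K : fieldType) (n : nat) (rho : K) (A B C : 'X_{1..n})
    (rho_neq0 : rho != 0) (AB0 : forall i : 'I_n, (A i * B i = 0)%N) :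
  process_terminates (initial_chart rho A B C).
Proof. exact/(@process_terminates_of_data _ _ rho)/initial_chart_data. Qed.
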